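(* Let $k$ be a positive integer. There exists a polynomial $g_k \in \mathbb{Q}[x,y]$ such that $g_k(0,0) = 0$ and, for every positive integer $n$, $$\sum_{m=1}^n m^k = g_k(S_1(n), S_2(n)).$$
   Context: For positive integers $k$ and $n$, $S_k(n) = \sum_{m=1}^n m^k$; in particular $S_1(n) = \sum_{m=1}^n m$ and $S_2(n) = \sum_{m=1}^n m^2$. *)

(* Defs.v *)
From mathcomp Require Import all_boot all_order all_algebra.
From mathcomp Require Import mpoly.

Set Implicit Arguments.
Unset Strict Implicit.
Unset Printing Implicit Defensive.

Definition power_sum (k n : nat) : nat := \sum_(1 <= m < n.+1) m ^ k.

Local Open Scope ring_scope.

(* {mpoly rat[2]} plays the role of Q[x, y], with x := 'X_0 and y := 'X_1. *)
Definition eval2 (g : {mpoly rat[2]}) (a b : rat) : rat :=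
  g.@[tnth [tuple a; b]].

(* Main.v *)
(** The polynomials in [n] of the form [g(S_1(n), S_2(n))] with [g(0,0) = 0] are
    exactly the multiples of [n(n+1)]: since [n(n+1) = 2 S_1],
    [n^2(n+1) = 3 S_2 - S_1] and [n^2 = 2 S_1 - n], every [n(n+1) n^j] is reached
    by a two-step recurrence.  Telescoping [m^(k+1) (m+1) - (m-1)^(k+1) m] then
    expresses [S_(k+1)(n)] through [n^(k+1) (n+1)] and the [S_i(n)] with
    [1 <= i <= k]. *)
Require Import Defs.
From mathcomp Require Import all_boot all_order all_algebra.
From mathcomp Require Import mpoly.
From mathcomp Require Import ring.
Import GRing.Theory Num.Theory.

Local Open Scope ring_scope.

(** These functions form a rational algebra without unit. The identity is asked at [n = 0] as well,
    where both power sums are empty, so [f 0 = 0]. *)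
Definition S1S2_expressible (f : nat -> rat) : Prop :=
  exists g : {mpoly rat[2]},
    eval2 g 0 0 = 0 /\
    forall n : nat, f n = eval2 g (power_sum 1 n)%:R (power_sum 2 n)%:R.

Lemma eq_expressible f h : f =1 h -> S1S2_expressible f -> S1S2_expressible h.
Proof. by move=> e [g [g0 gE]]; exists g; split=> // n; rewrite -e gE. Qed.

Lemma expressible0 : S1S2_expressible (fun=> 0).
Proof. by exists 0; split=> [|n]; rewrite /eval2 meval0. Qed.

Lemma expressibleD f h : S1S2_expressible f -> S1S2_expressible h ->
  S1S2_expressible (fun n => f n + h n).
Proof.
move=> [g [g0 gE]] [g' [g0' gE']]; exists (g + g').
split=> [|n]; first by rewrite /eval2 mevalD -!/(eval2 _ _ _) g0 g0' addr0.
by rewrite gE gE' /eval2 mevalD.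
Qed.

Lemma expressibleZ c f : S1S2_expressible f ->
  S1S2_expressible (fun n => c * f n).
Proof.
move=> [g [g0 gE]]; exists (c *: g).
split=> [|n]; first by rewrite /eval2 mevalZ -!/(eval2 _ _ _) g0 mulr0.
by rewrite gE /eval2 mevalZ.
Qed.

Lemma expressibleM f h : S1S2_expressible f -> S1S2_expressible h ->
  S1S2_expressible (fun n => f n * h n).
Proof.
move=> [g [g0 gE]] [g' [g0' gE']]; exists (g * g').
split=> [|n]; first by rewrite /eval2 mevalM -!/(eval2 _ _ _) g0 mul0r.
by rewrite gE gE' /eval2 mevalM.
Qed.

Lemma expressible_sum k (F : nat -> nat -> rat) :
  (forall i, (i < k)%N -> S1S2_expressible (F i)) ->
  S1S2_expressible (fun n => \sum_(i < k) F i n).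
Proof.
elim: k => [|k IHk] FP.
  by apply: eq_expressible expressible0 => n; rewrite big_ord0.
apply: (@eq_expressible (fun n => \sum_(i < k) F i n + F k n)).
  by move=> n; rewrite big_ord_recr.
by apply: expressibleD (FP _ _) => //; apply: IHk => i /ltnW; apply: FP.
Qed.

Lemma expressible_S1 : S1S2_expressible (fun n => (power_sum 1 n)%:R).
Proof. by exists 'X_ord0; split=> [|n]; rewrite /eval2 mevalXU. Qed.

Lemma expressible_S2 : S1S2_expressible (fun n => (power_sum 2 n)%:R).
Proof. by exists 'X_ord_max; split=> [|n]; rewrite /eval2 mevalXU. Qed.

Lemma power_sumS k n : power_sum k n.+1 = (power_sum k n + n.+1 ^ k)%N.
Proof. by rewrite /power_sum big_nat_recr. Qed.

Lemma power_sum1E n : 2 * (power_sum 1 n)%:R = n%:R * (n%:R + 1) :> rat.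
Proof.
elim: n => [|n IHn]; first by rewrite /power_sum big_geq.
rewrite power_sumS expn1 natrD mulrDr IHn -natr1; ring.
Qed.

Lemma power_sum2E n :
  6 * (power_sum 2 n)%:R = n%:R * (n%:R + 1) * (2 * n%:R + 1) :> rat.
Proof.
elim: n => [|n IHn]; first by rewrite /power_sum big_geq // !mul0r.
rewrite power_sumS natrD mulrDr IHn natrX -natr1; ring.
Qed.

Lemma expressible_pronicM j :
  S1S2_expressible (fun n => n%:R * (n%:R + 1) * n%:R ^+ j).
Proof.
(* The recurrence has order two, so the induction carries two consecutive exponents. *)
suff [] : S1S2_expressible (fun n => n%:R * (n%:R + 1) * n%:R ^+ j) /\
          S1S2_expressible (fun n => n%:R * (n%:R + 1) * n%:R ^+ j.+1) by [].
elim: j => [|j [IH0 IH1]].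
  split.
    apply: eq_expressible (expressibleZ 2 _ expressible_S1) => n.
    by rewrite power_sum1E mulr1.
  apply: eq_expressible (expressibleD _ _ (expressibleZ 3 _ expressible_S2)
                           (expressibleZ (-1) _ expressible_S1)) => n.
  (* Doubling [3 S_2 - S_1] makes the closed forms of [6 S_2] and [2 S_1] applicable. *)
  apply: (@mulfI _ 2) => //.
  transitivity (6 * (power_sum 2 n)%:R - 2 * (power_sum 1 n)%:R : rat);
    first by ring.
  rewrite power_sum1E power_sum2E; ring.
split=> //.
(* Multiply [n^2 = n(n+1) - n] by [n(n+1) n^j]; the factor [n(n+1)] is [2 S_1]. *)
apply: eq_expressible
  (expressibleD _ _ (expressibleM _ _ (expressibleZ 2 _ expressible_S1) IH0)
     (expressibleZ (-1) _ IH1)) => n.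
rewrite power_sum1E !exprS; ring.
Qed.

(** The sum is [x] times the part of [(x-1)^(k+1)] of degree below [k]. The outer factor [x] keeps
    every exponent at least 1, so summing over [x] never brings in [S_0(n) = n]. *)
Lemma telescoping_term k (x : rat) :
  k.+2%:R * x ^+ k.+1 =
    ((x + 1) * x ^+ k.+1 - x * (x - 1) ^+ k.+1)
    + \sum_(i < k) ((-1) ^+ (k.+1 - i) *+ 'C(k.+1, i)) * x ^+ i.+1.
Proof.
have -> : \sum_(i < k) ((-1) ^+ (k.+1 - i) *+ 'C(k.+1, i)) * x ^+ i.+1 =
          x * ((x - 1) ^+ k.+1 - x ^+ k.+1 + k.+1%:R * x ^+ k).
  (* The two top terms of the binomial expansion, [x^(k+1)] and [-(k+1) x^k], are split off and
     cancel. *)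
  rewrite [x - 1]addrC exprDn !big_ord_recr /= subnn subSnn binn binSn.
  rewrite expr0 expr1 mulr1n mul1r mulN1r.
  transitivity (x * \sum_(i < k) (-1) ^+ (k.+1 - i) * x ^+ i *+ 'C(k.+1, i));
    last by rewrite -[_ *+ k.+1]mulr_natl; ring.
  rewrite mulr_sumr; apply: eq_bigr => i _.
  by rewrite exprS mulrnAl mulrnAr mulrCA.
rewrite -!natr1 exprS; ring.
Qed.

Lemma expressible_sumX k :
  S1S2_expressible (fun n => \sum_(1 <= m < n.+1) (m%:R : rat) ^+ k.+1).
Proof.
elim/ltn_ind: k => k IHk.
pose c i : rat := (-1) ^+ (k.+1 - i) *+ 'C(k.+1, i).
have sumP : S1S2_expressible (fun n => \sum_(i < k)
    c i * \sum_(1 <= m < n.+1) (m%:R : rat) ^+ i.+1).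
  apply: (expressible_sum k
    (fun i n => c i * \sum_(1 <= m < n.+1) (m%:R : rat) ^+ i.+1)) => i /IHk.
  exact: expressibleZ.
apply: eq_expressible
  (expressibleZ k.+2%:R^-1 _ (expressibleD _ _ (expressible_pronicM k) sumP)) => n.
(* Clear the denominator, then expand each [(k+2) m^(k+1)] by [telescoping_term]. *)
apply: (@mulfI _ k.+2%:R); first by rewrite pnatr_eq0.
rewrite mulVKf ?pnatr_eq0 // [RHS]mulr_sumr.
under [RHS]eq_bigr do rewrite telescoping_term.
rewrite big_split /=; congr (_ + _); last first.
  by rewrite exchange_big /=; apply: eq_bigr => i _; rewrite mulr_sumr.
(* The bracketed term at [m] is [T (m+1) - T m]. As [T 1 = 0], only [T (n+1) = (n+1) n^(k+1)]
   survives. *)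
pose T m : rat := m%:R * (m%:R - 1) ^+ k.+1.
transitivity (\sum_(1 <= m < n.+1) (T m.+1 - T m)).
  rewrite telescope_sumr // /T -natr1 addrK subrr expr0n mulr0 subr0 exprS; ring.
by apply: eq_bigr => m _; rewrite /T -natr1 addrK.
Qed.

Theorem theorem1 (k : nat) (k_gt0 : (0 < k)%N) :
  exists g : {mpoly rat[2]},
    eval2 g 0 0 = 0 /\
    forall n : nat, (0 < n)%N ->
      \sum_(1 <= m < n.+1) (m%:R : rat) ^+ k
        = eval2 g (power_sum 1 n)%:R (power_sum 2 n)%:R.
Proof.
case: k k_gt0 => // k _.
by have [g [g0 gE]] := expressible_sumX k; exists g; split=> // n _; apply: gE.
Qed.
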